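(* Let $u$ be a unitary element of the Cuntz algebra $\mathcal{O}_2$, and let $\lambda_u$ be the unital $*$-endomorphism of $\mathcal{O}_2$ with $\lambda_u(S_i)=uS_i$ for $i=1,2$. Then $\lambda_u(V)\subseteq V$ if and only if $u\in V$.
   Context: The Cuntz algebra $\mathcal{O}_2$ is the $C^*$-algebra generated by two isometries $S_1,S_2$ with $S_1S_1^*+S_2S_2^*=1$. For every unitary $u\in\mathcal{O}_2$ there is a unique unital $*$-endomorphism $\lambda_u$ of $\mathcal{O}_2$ with $\lambda_u(S_i)=uS_i$, $i=1,2$, and every unital $*$-endomorphism of $\mathcal{O}_2$ is of this form. $W_2$ is the set of all finite words (multi-indices, including the empty word $\emptyset$) in the alphabet $\{1,2\}$. For $\mu=\mu_1\ldots\mu_k\in W_2$ put $S_\mu=S_{\mu_1}\cdots S_{\mu_k}$, with $S_\emptyset=1$. $V$ denotes the Thompson group $V$ realized as a subgroup of the unitary group of $\mathcal{O}_2$: it is the group of all unitaries of $\mathcal{O}_2$ of the form $\sum_{(\alpha,\beta)\in\mathcal{J}}S_\alpha S_\beta^*$ with $\mathcal{J}$ a finite collection of pairs in $W_2\times W_2$. *)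

(* Defs.v *)
From HB Require Import structures.
From mathcomp Require Import all_boot all_order all_algebra finmap complex.
From mathcomp Require Import all_classical all_reals all_analysis.

Set Implicit Arguments.
Unset Strict Implicit.
Unset Printing Implicit Defensive.

Import Order.TTheory GRing.Theory Num.Theory.
Import numFieldNormedType.Exports.
Import ComplexField.Normc.

Local Open Scope classical_set_scope.
Local Open Scope ring_scope.

(* The norm is a field of the mixin: MathComp has no structure that is both a
   noncommutative ring and a normed module, and Hierarchy-Builder does not allow
   one to be added after [numDomainType].  Nonnegativity of [cnorm] follows from
   the triangle inequality and homogeneity. *)
HB.mixin Record isCStarAlgebra (R : realType) A & GRing.Algebra R[i] A := {
  cnorm : A -> R ;
  cnorm_eq0 : forall x, cnorm x = 0 -> x = 0 ;
  ler_cnormD : forall x y, cnorm (x + y) <= cnorm x + cnorm y ;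
  cnormZ : forall (a : R[i]) x, cnorm (a *: x) = normc a * cnorm x ;
  ler_cnormM : forall x y, cnorm (x * y) <= cnorm x * cnorm y ;
  cnorm_complete : forall x : nat -> A,
    (forall e : R, 0 < e ->
      exists N, forall m n, (N <= m)%N -> (N <= n)%N -> cnorm (x m - x n) < e) ->
    exists l, (fun n => cnorm (x n - l)) @ \oo --> (0 : R) ;
  star : A -> A ;
  starK : involutive star ;
  starD : {morph star : x y / x + y} ;
  starZ : forall (a : R[i]) x, star (a *: x) = a^* *: star x ;
  starM : forall x y, star (x * y) = star y * star x ;
  cnorm_starM : forall x, cnorm (star x * x) = cnorm x ^+ 2
}.

(* Unital and nonzero, since [GRing.Algebra] includes [1 != 0]. *)
#[short(type="cstarAlgType")]
HB.structure Definition CStarAlgebra (R : realType) :=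
  {A of isCStarAlgebra R A & GRing.Algebra R[i] A}.

Section CStar.
Context {R : realType} {A : cstarAlgType R}.

Definition isometry (s : A) : Prop := star s * s = 1.

Definition unitary (u : A) : Prop := star u * u = 1 /\ u * star u = 1.

Definition cnorm_closed (B : set A) : Prop :=
  forall (x : nat -> A) (l : A), (forall n, B (x n)) ->
    (fun n => cnorm (x n - l)) @ \oo --> (0 : R) -> B l.

Definition cstar_subalgebra (B : set A) : Prop :=
  [/\ B 0,
      forall (a : R[i]) x y, B x -> B y -> B (a *: x + y),
      forall x y, B x -> B y -> B (x * y),
      forall x, B x -> B (star x)
    & cnorm_closed B].

Definition cstar_generated (G : set A) : set A := smallest cstar_subalgebra G.

(* [A], with generators [S], is the Cuntz algebra O_2.  By Cuntz's uniqueness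
   theorem this determines [(A, S)] up to isomorphism. *)
Definition is_cuntz2 (S : 'I_2 -> A) : Prop :=
  [/\ forall i, isometry (S i),
      \sum_(i < 2) S i * star (S i) = 1
    & cstar_generated (range S) = [set: A]].

Definition star_endomorphism (f : {lrmorphism A -> A}) : Prop :=
  forall x, f (star x) = star (f x).

Definition word2 := seq 'I_2.

Definition Sword (S : 'I_2 -> A) (mu : word2) : A := \prod_(i <- mu) S i.

Definition thompsonV (S : 'I_2 -> A) : set A :=
  [set v | unitary v /\ exists J : {fset word2 * word2},
     v = \sum_(p <- J) Sword S p.1 * star (Sword S p.2)].

End CStar.

(* Main.v *)
From HB Require Import structures.
Require Import Defs.
From mathcomp Require Import all_boot all_order all_algebra finmap complex.
From mathcomp Require Import zify.
From mathcomp Require Import all_classical all_reals all_analysis.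
Set Implicit Arguments.
Unset Strict Implicit.
Unset Printing Implicit Defensive.
Import GRing.Theory Num.Theory ComplexField.Normc.
Local Open Scope classical_set_scope.
Local Open Scope ring_scope.

(** Let f be the endomorphism with f(S_i) = u S_i, and write s, t for the two
generators.  A word sum is an element of the semiring generated by the S_i and
their adjoints, that is, a finite sum of monomials S_a S_b^* with natural
coefficients.

The link with V is that a word sum x which is an isometry permutes long words:
x S_b = S_a for every b beyond some length ([word_isometry_columns]).  Indeed
x S_b is a sum of words S_a, and compressing (x S_b)^* (x S_b) = 1 by a suitable
word turns the pairs of equal summands into 1 and all the others into 0, so
there is exactly one summand.  Hence V consists of the unitary word sums
([thompsonVE]), and the implication from u in V to f(V) in V follows, since f
then maps word sums to word sums.

For the converse it is enough that f(s) and f(t) be word sums, because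
u = f(s) s^* + f(t) t^*.  The point is to show that the projection f(s s^* ) is
a sum of projections S_b S_b^*.  If g in V moves only the cylinder of s and h
moves only that of t, then (g - 1)(h - 1) = 0, so v = f(g) and w = f(h) are
elements of V with v w + 1 = v + w.  If neither v nor w fixed S_b, for b long,
the coefficient of this relation at b would read n + 1 = 0 with n natural.  So
every long b is fixed by v or by w ([fixed_columns]), and for finitely many g
and h one gets p + q = 1, sums of projections S_b S_b^*, such that every f(g)
fixes q and every f(h) fixes p ([fixed_split]).

Finally, in a Cuntz algebra V has no nonzero fixed vector, and two elements of V
already suffice for that ([fixed_eq0]).  Applied to f(s)^* q and f(t)^* p, this
gives f(s s^* ) q = 0 and f(t t^* ) p = 0, that is, f(s s^* ) = p.  Since s and t
are word expressions in elements of V and the two projections s s^* and t t^*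
([gen1_rot_swap]), their images under f are word sums. *)

(** * Pairs of isometries satisfying the Cuntz relation *)

Section StarAlgebra.
Context {R : realType} {A : cstarAlgType R}.
Implicit Types s t x y g h : A.

Lemma star_zmod_morphism : zmod_morphism (@star R A).
Proof.
have star0 : star (0 : A) = 0.
  by apply: (@addrI _ (star 0)); rewrite -starD !addr0.
by move=> x y; rewrite starD; congr (_ + _); apply: (@addrI _ (star y));
  rewrite -starD !subrr star0.
Qed.

HB.instance Definition _ :=
  GRing.isZmodMorphism.Build A A (@star R A) star_zmod_morphism.

Lemma star1 : star (1 : A) = 1.
Proof. by rewrite -[RHS]starK -[star 1 in RHS]mul1r starM starK mul1r. Qed.

Lemma star_mul_eq0 x : star x * x = 0 -> x = 0.
Proof.
move=> xx0; apply/cnorm_eq0/eqP; rewrite -sqrf_eq0 -cnorm_starM xx0.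
by rewrite -(scale0r (0 : A)) cnormZ normc0 mul0r.
Qed.

(** Holds because A is a nonzero algebra over a field of characteristic 0; the
arguments below compare natural multiples of 1. *)
Lemma natr_inj : injective (fun n => n%:R : A).
Proof.
move=> m n /=; rewrite -!(rmorph_nat (in_alg A)) => /fmorph_inj/eqP.
by rewrite eqr_nat => /eqP.
Qed.

Definition cuntz_pair s t : Prop :=
  [/\ star s * s = 1, star t * t = 1 & s * star s + t * star t = 1].

Lemma cuntz_pairC s t : cuntz_pair s t -> cuntz_pair t s.
Proof. by case=> s1 t1; rewrite addrC. Qed.

Lemma cuntz_pair_orth s t : cuntz_pair s t -> star s * t = 0.
Proof.
move=> [s1 t1 e]; apply: (@addrI _ (star s * t)).
rewrite addr0 -{3}[star s]mulr1 -e mulrDr mulrDl !mulrA s1 mul1r.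
by rewrite -(mulrA _ (star t)) t1 mulr1.
Qed.

Lemma cuntz_pairE s t : cuntz_pair s t ->
  ((star s * s = 1) * (star t * t = 1) * (star s * t = 0) * (star t * s = 0)) *
  ((forall x, star s * (s * x) = x) * (forall x, star t * (t * x) = x) *
   (forall x, star s * (t * x) = 0) * (forall x, star t * (s * x) = 0)).
Proof.
move=> h; have st := cuntz_pair_orth h.
have ts := cuntz_pair_orth (cuntz_pairC h).
case: (h) => s1 t1 _; split; first by do !split.
by split; [split; [split|]|] => x;
  rewrite mulrA ?(s1, t1, st, ts) ?(mul1r, mul0r).
Qed.

(** [swap] and [rot] are the elements of V exchanging the cylinders 1 and 2,
respectively mapping the cylinders 11, 12, 2 to 1, 21, 22; the second one is a
standard generator of the Thompson group F.  They are defined for an arbitrary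
pair, so that an endomorphism maps those of s, t to those of the images. *)
Definition swap s t := s * star t + t * star s.
Definition rot s t :=
  s * star (s * s) + t * s * star (s * t) + t * t * star t.
(** The copy of g that acts on the range of s and is the identity on the range
of t. *)
Definition lift_on s t g := s * g * star s + t * star t.

(* Multiplies out a product of words in the generators and their adjoints and
   cancels adjacent factors by means of the relations of h. *)
Ltac expand h := rewrite ?(starM, starD, starK) ?(mulrDl, mulrDr) -?mulrA;
  rewrite ?(cuntz_pairE h, mulr0, addr0, add0r, mulr1).

Lemma swap_unitary s t : cuntz_pair s t -> unitary (swap s t).
Proof.
by move=> h; split; rewrite /swap; expand h; case: h => _ _ //; rewrite addrC.
Qed.

Lemma rot_unitary s t : cuntz_pair s t -> unitary (rot s t).
Proof.
move=> h; split; rewrite /rot; expand h; case: (h) => _ _ e.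
  by rewrite -mulrDr (mulrA s (star s)) (mulrA t (star t)) -mulrDl e mul1r.
by rewrite -addrA -mulrDr (mulrA s (star s)) (mulrA t (star t)) -mulrDl e mul1r.
Qed.

Lemma lift_on_unitary s t g :
  cuntz_pair s t -> unitary g -> unitary (lift_on s t g).
Proof.
move=> h [g1 g2]; have [_ _ e] := h.
split; rewrite /lift_on; expand h.
  by rewrite (mulrA (star g)) g1 mul1r.
by rewrite (mulrA g) g2 mul1r.
Qed.

Lemma star_lift_on s t g :
  cuntz_pair s t -> star s * lift_on s t g = g * star s.
Proof. by move=> h; rewrite /lift_on; expand h. Qed.

(** The two factors move disjoint cylinders, so (g' - 1)(h' - 1) = 0 for the
lifts g' and h'; the relation is written without subtraction in order to remain
meaningful for sums of words with natural coefficients. *)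
Lemma lift_on_mul s t g h : cuntz_pair s t ->
  lift_on s t g * lift_on t s h + 1 = lift_on s t g + lift_on t s h.
Proof.
move=> st; have [_ _ e] := st; rewrite /lift_on -[X in _ + X]e; expand st.
by rewrite (addrC (s * star s)) addrACA.
Qed.

(** On the range of s, s agrees with [star (rot s t)], which maps s to s * s; on
the range of t it agrees with an element of V that maps t to s * t.  So s is
recovered from V and the two range projections. *)
Lemma gen1_rot_swap s t (g := swap s t) (r := star (rot s t)) :
  cuntz_pair s t -> r * s * star s + r * g * r * g * t * star t = s.
Proof.
move=> h; have [_ _ e] := h.
have gs : g * s = t by rewrite /g /swap; expand h.
have gt : g * t = s by rewrite /g /swap; expand h.
have rs : r * s = s * s by rewrite /r /rot; expand h.
have rt : r * (t * s) = s * t by rewrite /r /rot; expand h.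
rewrite -!(mulrA _ g t) gt -(mulrA _ r s) rs (mulrA _ s s) -(mulrA _ g s) gs.
by rewrite -(mulrA r t s) rt -!mulrA -mulrDr e mulr1.
Qed.

(** A vector y fixed by both elements satisfies s^* y = t^* y by [swap], and by
[rot] the vector T = s^* y satisfies s^* T = t^* T = T.  Hence T = (s + t) T, and
since (s + t)^* (s + t) = 2, T^* T = 2 T^* T and T vanishes. *)
Lemma fixed_eq0 s t y : cuntz_pair s t ->
  rot s t * y = y -> swap s t * y = y -> y = 0.
Proof.
move=> h ry sy; have [_ _ e] := h.
have ts : star t * y = star s * y by rewrite -[in LHS]sy /swap; expand h.
have ss : star s * (star s * y) = star s * y.
  by rewrite -[in RHS]ry /rot; expand h.
have st : star t * (star s * y) = star s * y.
  by rewrite -[RHS]ss -[in RHS]ts -[in RHS]ry /rot; expand h.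
have self T : (s + t) * T = T -> T = 0.
  move=> hT; apply: star_mul_eq0; apply: (@addrI _ (star T * T)).
  by rewrite addr0 -[in RHS]hT; expand h.
have s0 : star s * y = 0.
  by apply: self; rewrite -[RHS]mul1r -e !mulrDl -!mulrA ss st.
by rewrite -[y]mul1r -e mulrDl -!mulrA ts s0 !mulr0 addr0.
Qed.

End StarAlgebra.

Lemma letterP (i : 'I_2) : i = ord0 \/ i = ord_max.
Proof. by case: i => [[|[|k]] hk] //; [left|right]; apply: val_inj. Qed.

(** * Words and sums of words *)

Section Words.
Context {R : realType} {A : cstarAlgType R} (S : 'I_2 -> A).
Context (hS : cuntz_pair (S ord0) (S ord_max)).
Implicit Types (a b : word2) (x y v w : A).

Lemma Sword_cons i a : Sword S (i :: a) = S i * Sword S a.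
Proof. exact: big_cons. Qed.

Lemma Sword_cat a b : Sword S (a ++ b) = Sword S a * Sword S b.
Proof. exact: big_cat. Qed.

Lemma Sword_nil : Sword S [::] = 1.
Proof. exact: big_nil. Qed.

Lemma star_gen_mul i j : star (S i) * S j = (i == j)%:R.
Proof.
by case: (letterP i) => ->; case: (letterP j) => ->; rewrite (cuntz_pairE hS).
Qed.

Lemma star_Sword_cons i j a b :
  star (Sword S (i :: a)) * Sword S (j :: b) =
  if i == j then star (Sword S a) * Sword S b else 0.
Proof.
rewrite !Sword_cons starM -mulrA (mulrA (star (S i))) star_gen_mul.
by case: eqP; rewrite ?mul1r // mul0r mulr0.
Qed.

Lemma Sword_isometry a : star (Sword S a) * Sword S a = 1.
Proof.
by elim: a => [|i a IH];
  rewrite ?star_Sword_cons ?eqxx // Sword_nil star1 mulr1.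
Qed.

(** The word 1...12, where the letter 1 is repeated n times.  Appended to two
different words that are short with respect to n, it makes them incomparable for
the prefix order. *)
Definition marker n : word2 := rcons (nseq n ord0) ord_max.

(** The letter 2 that ends the first word stands at a position where the second
word still runs through the letters 1 of its marker. *)
Lemma marker_orth k n b : (size b <= k < size b + n)%N ->
  star (Sword S (marker k)) * Sword S (b ++ marker n) = 0.
Proof.
elim: b k => [|j b IH] k /=.
  elim: k n => [|k IH] [|n] //= kn; rewrite /marker /= star_Sword_cons //=.
  by apply: IH.
case: k => [|k] //; rewrite addSn !ltnS => hk.
by rewrite /marker /= star_Sword_cons; case: eqP => // _; apply: IH.
Qed.

(** Compressing by a long marker thus plays the part of a vector state: it reads
off whether two words agree. *)
Lemma star_Sword_marker a b n : (size a <= n)%N -> (size b <= n)%N ->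
  star (Sword S (a ++ marker n)) * Sword S (b ++ marker n) = (a == b)%:R.
Proof.
elim: a b => [|i a IH] [|j b] an bn.
- by rewrite Sword_isometry.
- by rewrite marker_orth //= bn addSn ltnS leq_addl.
- rewrite -[LHS]starK starM starK marker_orth ?raddf0 //.
  by rewrite an /= addSn ltnS leq_addl.
rewrite !cat_cons star_Sword_cons eqseq_cons; case: eqP => //= _.
by apply: IH; apply: ltnW.
Qed.

Fixpoint words n : seq word2 :=
  if n is m.+1 then map (cons ord0) (words m) ++ map (cons ord_max) (words m)
  else [:: [::]].

Lemma size_words n b : b \in words n -> size b = n.
Proof.
elim: n b => [|n IH] b /=; first by rewrite inE => /eqP->.
by rewrite mem_cat => /orP[] /mapP[c /IH <- ->].
Qed.

Lemma words_uniq n : uniq (words n).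
Proof.
elim: n => //= n IH; rewrite cat_uniq !map_inj_uniq ?IH //=; last 2 first.
- by move=> ? ? [].
- by move=> ? ? [].
by rewrite andbT; apply/hasPn => _ /mapP[c _ ->]; apply/mapP => -[].
Qed.

Lemma sum_words n : \sum_(b <- words n) Sword S b * star (Sword S b) = 1.
Proof.
have [_ _ e] := hS.
elim: n => [|n IH]; first by rewrite big_seq1 Sword_nil star1 mulr1.
rewrite big_cat !big_map -[RHS]e -{1}[S ord0]mulr1 -{1}[S ord_max]mulr1 -IH.
rewrite !mulr_sumr !mulr_suml; congr (_ + _); apply: eq_bigr => b _;
  by rewrite Sword_cons starM !mulrA.
Qed.

(** An inductive closure is used rather than explicit lists of monomials, so that
stability under products needs no normal form. *)
Inductive word_sum : A -> Prop :=
| word_sum0 : word_sum 0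
| word_sum1 : word_sum 1
| word_sum_gen i : word_sum (S i)
| word_sum_star_gen i : word_sum (star (S i))
| word_sumD x y : word_sum x -> word_sum y -> word_sum (x + y)
| word_sumM x y : word_sum x -> word_sum y -> word_sum (x * y).

Lemma word_sum_star x : word_sum x -> word_sum (star x).
Proof.
elim=> [||i|i|y z _ hy _ hz|y z _ hy _ hz].
- by rewrite raddf0; constructor.
- by rewrite star1; constructor.
- by constructor.
- by rewrite starK; constructor.
- by rewrite starD; constructor.
- by rewrite starM; constructor.
Qed.

Lemma word_sum_Sword a : word_sum (Sword S a).
Proof.
by elim: a => [|i a IH]; rewrite ?Sword_nil ?Sword_cons; do ?constructor.
Qed.

Lemma word_sum_monomials (I : Type) (r : seq I) (P : pred I) (f g : I -> word2) :
  word_sum (\sum_(i <- r | P i) Sword S (f i) * star (Sword S (g i))).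
Proof.
apply: big_ind => [|x y|i _]; first exact: word_sum0.
  exact: word_sumD.
by apply: word_sumM; last apply: word_sum_star; apply: word_sum_Sword.
Qed.

(** Long words absorb all the adjoints; for a product, the word must be long
enough to remain long after the action of the right factor. *)
Lemma word_sum_columns x : word_sum x -> exists L, forall b, (L <= size b)%N ->
  exists m : seq word2, x * Sword S b = \sum_(a <- m) Sword S a.
Proof.
elim=> [||i|i|y z _ [L hL] _ [M hM]|y z _ [L hL] _ [M hM]].
- by exists 0%N => b _; exists [::]; rewrite big_nil mul0r.
- by exists 0%N => b _; exists [:: b]; rewrite big_seq1 mul1r.
- by exists 0%N => b _; exists [:: i :: b]; rewrite big_seq1 Sword_cons.
- exists 1%N => -[|j b] // _; rewrite Sword_cons mulrA star_gen_mul.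
  case: eqP => _; last by exists [::]; rewrite big_nil mul0r.
  by exists [:: b]; rewrite big_seq1 mul1r.
- exists (maxn L M) => b; rewrite geq_max => /andP[/hL[m e] /hM[m' e']].
  by exists (m ++ m'); rewrite mulrDl e e' big_cat.
(* The prefix of length M is long enough for z; the remaining letters make the
   resulting words long enough for y. *)
exists (M + L)%N => b hb.
have /hM[m hm] : (M <= size (take M b))%N.
  by rewrite size_take_min leq_min leqnn (leq_trans _ hb) // leq_addr.
rewrite -(cat_take_drop M b) Sword_cat -mulrA (mulrA z) hm.
rewrite mulr_suml mulr_sumr; elim: m {hm} => [|a m [m' IH]].
  by exists [::]; rewrite !big_nil.
have /hL[m'' e] : (L <= size (a ++ drop M b))%N.
  by rewrite size_cat size_drop; lia.
by exists (m'' ++ m'); rewrite big_cons IH -Sword_cat e big_cat.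
Qed.

(** Compressing y^* y = 1 by a long marker shows that the sum over a in m of the
multiplicity of a is 1, so m has one element. *)
Lemma isometric_sum_Sword (m : seq word2) (y := \sum_(a <- m) Sword S a) :
  star y * y = 1 -> exists a, y = Sword S a.
Proof.
move=> yy; pose n := (\sum_(a <- m) size a)%N.
have hn a : a \in m -> (size a <= n)%N.
  by move=> am; rewrite /n (big_rem a am) leq_addr.
pose e := Sword S (marker n).
have : (\sum_(a <- m) count_mem a m)%N%:R = 1%:R :> A.
  transitivity (star e * (star y * y * e)); last first.
    by rewrite yy mul1r Sword_isometry.
  rewrite natr_sum /y raddf_sum /= mulr_suml mulr_suml mulr_sumr.
  rewrite big_seq [RHS]big_seq; apply: eq_bigr => a am.
  rewrite -sum1_count natr_sum big_mkcond /= mulr_sumr mulr_suml mulr_sumr.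
  rewrite big_seq [RHS]big_seq; apply: eq_bigr => b bm.
  rewrite !mulrA -mulrA -starM -!Sword_cat star_Sword_marker ?hn //.
  by rewrite eq_sym; case: eqP.
move=> /natr_inj; rewrite /y; case: m {yy hn e y n} => [|a [|b m]].
- by rewrite big_nil.
- by exists a; rewrite big_seq1.
by rewrite !big_cons /= !eqxx => ?; lia.
Qed.

Lemma word_isometry_columns x : word_sum x -> star x * x = 1 ->
  exists L, forall b, (L <= size b)%N -> exists a, x * Sword S b = Sword S a.
Proof.
move=> /word_sum_columns[L hL] xx; exists L => b /hL[m e].
have [|a ha] := @isometric_sum_Sword m; last by exists a; rewrite e.
by rewrite -e starM -mulrA (mulrA (star x)) xx mul1r Sword_isometry.
Qed.

(** A unitary word sum equals the sum over the words b of a fixed length of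
S_a S_b^*, where S_a is the image of S_b; these pairs (a, b) are pairwise
distinct, so they form a set as the definition of V demands. *)
Lemma thompsonVE v : thompsonV S v <-> unitary v /\ word_sum v.
Proof.
split=> [[uv [J e]]|[uv hv]].
  by split=> //; rewrite e; apply: word_sum_monomials.
split=> //; have [vv _] := uv; have [L hL] := word_isometry_columns hv vv.
have /choice[f hf] b : exists a, (L <= size b)%N -> v * Sword S b = Sword S a.
  by have [/hL[a e]|_] := leqP L (size b); [exists a|exists b].
pose s := [seq (f b, b) | b <- words L].
have us : uniq s by rewrite map_inj_uniq ?words_uniq // => b b' [].
exists (seq_fset tt s).
rewrite (perm_big s); last first.
  by rewrite -[X in perm_eq _ X](undup_id us) seq_fset_perm.
rewrite big_map -[LHS]mulr1 -(sum_words L) mulr_sumr big_seq [RHS]big_seq.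
by apply: eq_bigr => b /size_words hb; rewrite mulrA hf ?hb.
Qed.

(** If v and w map S_b to words other than S_b, compressing v w + 1 = v + w by a
long word extending b leaves n + 1 = 0 with n equal to 0 or 1. *)
Lemma fixed_columns v w : word_sum v -> word_sum w ->
  star v * v = 1 -> star w * w = 1 -> v * w + 1 = v + w ->
  exists L, forall b, (L <= size b)%N ->
    v * Sword S b = Sword S b \/ w * Sword S b = Sword S b.
Proof.
move=> hv hw vv ww vw.
have [Lv cv] := word_isometry_columns hv vv.
have [Lw cw] := word_isometry_columns hw ww.
have [|Lc cc] := word_isometry_columns (word_sumM hv hw).
  by rewrite starM mulrA -(mulrA (star w)) vv mulr1.
exists (maxn Lv (maxn Lw Lc)) => b.
rewrite !geq_max => /and3P[/cv[a ea] /cw[c ec] /cc[d ed]].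
have [ab|ab] := eqVneq a b; first by left; rewrite ea ab.
have [cb|cb] := eqVneq c b; first by right; rewrite ec cb.
pose n := (size a + size b + size c + size d)%N.
pose e := Sword S (b ++ marker n).
have := congr1 (fun z => star e * (z * e)) vw.
rewrite /e !mulrDl !mulrDr mul1r Sword_isometry.
rewrite (Sword_cat b) !(mulrA _ (Sword S b)) ea ec ed.
rewrite -!Sword_cat !star_Sword_marker; try by rewrite /n; lia.
rewrite ![b == _]eq_sym (negPf ab) (negPf cb).
by rewrite -(natrD A _ 1) -natrD addn1 => /natr_inj.
Qed.

(** At a length n that works for all pairs i, j, a word not fixed by some v i is
fixed by all the w j; p is the sum of the projections S_b S_b^* over such words b,
and q the sum over the others. *)
Lemma fixed_split (I : finType) (v w : I -> A) :
  (forall i, word_sum (v i) /\ star (v i) * v i = 1) ->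
  (forall i, word_sum (w i) /\ star (w i) * w i = 1) ->
  (forall i j, v i * w j + 1 = v i + w j) ->
  exists p q, [/\ word_sum p, word_sum q, p + q = 1,
    forall i, v i * q = q & forall i, w i * p = p].
Proof.
move=> hv hw vw.
have /choice[L hL] ij : exists L, forall b, (L <= size b)%N ->
    v ij.1 * Sword S b = Sword S b \/ w ij.2 * Sword S b = Sword S b.
  by apply: fixed_columns; rewrite ?vw //; case: (hv ij.1) (hw ij.2) => ? ? [].
pose n := (\max_ij L ij)%N.
pose P b := [forall i, v i * Sword S b == Sword S b].
pose pr b := Sword S b * star (Sword S b).
exists (\sum_(b <- words n | ~~ P b) pr b), (\sum_(b <- words n | P b) pr b).
split; try exact: word_sum_monomials.
- by rewrite addrC -(sum_words n) [RHS](bigID P).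
- move=> i; rewrite mulr_sumr; apply: eq_bigr => b /forallP/(_ i)/eqP e.
  by rewrite mulrA e.
move=> j; rewrite mulr_sumr big_seq_cond [RHS]big_seq_cond.
apply: eq_bigr => b /andP[/size_words hb /forallPn[i /eqP ne]].
have [|//|e] := hL (i, j) b; last by rewrite mulrA e.
by rewrite hb; apply: leq_bigmax.
Qed.

End Words.

(** * Endomorphisms that preserve the Thompson group *)

Section StarEndomorphism.
Context {R : realType} {A : cstarAlgType R} (S : 'I_2 -> A).
Context (hS : cuntz_pair (S ord0) (S ord_max)).
Context (f : {lrmorphism A -> A}) (hf : star_endomorphism f).
Local Notation s := (S ord0).
Local Notation t := (S ord_max).

Lemma star_endo_unitary x : unitary x -> unitary (f x).
Proof. by move=> [x1 x2]; split; rewrite -hf -rmorphM ?x1 ?x2 rmorph1. Qed.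

Lemma star_endo_cuntz_pair : cuntz_pair (f s) (f t).
Proof.
by case: hS => s1 t1 e; split;
  rewrite -!hf -!rmorphM ?s1 ?t1 -?rmorphD ?e rmorph1.
Qed.

Lemma star_endo_swap : f (swap s t) = swap (f s) (f t).
Proof. by rewrite /swap -!hf -!rmorphM -rmorphD. Qed.

Lemma star_endo_rot : f (rot s t) = rot (f s) (f t).
Proof. by rewrite /rot -!rmorphM -!hf -!rmorphM -!rmorphD. Qed.

Lemma star_endo_word_sum x :
  (forall i, word_sum S (f (S i))) -> word_sum S x -> word_sum S (f x).
Proof.
move=> fS; elim=> [||i|i|y z _ hy _ hz|y z _ hy _ hz].
- by rewrite rmorph0; constructor.
- by rewrite rmorph1; constructor.
- exact: fS.
- by rewrite hf; apply: word_sum_star.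
- by rewrite rmorphD; constructor.
- by rewrite rmorphM; constructor.
Qed.

(** Since [star x] intertwines [lift_on x y g] with g, the element f(x)^* p is
fixed by the images of [rot] and [swap], hence is zero. *)
Lemma star_endo_corner x y p :
  cuntz_pair x y -> f (lift_on x y (rot s t)) * p = p ->
  f (lift_on x y (swap s t)) * p = p -> f (star x) * p = 0.
Proof.
move=> h hr hs; apply: (fixed_eq0 star_endo_cuntz_pair).
  by rewrite -star_endo_rot mulrA -rmorphM -(star_lift_on _ h) rmorphM -mulrA hr.
by rewrite -star_endo_swap mulrA -rmorphM -(star_lift_on _ h) rmorphM -mulrA hs.
Qed.

Context (fV : forall v, thompsonV S v -> thompsonV S (f v)).

(** With g ranging over [rot] and [swap], lifted to the range of s and to that of
t, the splitting p + q = 1 identifies f(s s^* ) with p and f(t t^* ) with q. *)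
Lemma word_sum_gens i : word_sum S (f (S i)).
Proof.
have fM x y : f (x * y) = f x * f y by rewrite rmorphM.
have fD x y : f (x + y) = f x + f y by rewrite rmorphD.
have f1 : f 1 = 1 by rewrite rmorph1.
pose g (k : bool) := if k then rot s t else swap s t.
have ws_star := @word_sum_star R A S.
have gU k : unitary (g k) /\ word_sum S (g k).
  case: k; split; rewrite /g; [exact: rot_unitary|..|exact: swap_unitary|];
    by rewrite ?/rot ?/swap;
      repeat first [apply: ws_star; do ![constructor]|constructor].
have fU x : unitary x -> word_sum S x ->
    word_sum S (f x) /\ star (f x) * f x = 1.
  move=> ux wx; have Vx := (thompsonVE hS x).2 (conj ux wx).
  by have /(thompsonVE hS)[[]] := fV Vx.
have lU k : word_sum S (f (lift_on s t (g k))) /\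
    star (f (lift_on s t (g k))) * f (lift_on s t (g k)) = 1.
  have [uk wk] := gU k; apply: fU; first exact: lift_on_unitary.
  by rewrite /lift_on; repeat constructor.
have rU k : word_sum S (f (lift_on t s (g k))) /\
    star (f (lift_on t s (g k))) * f (lift_on t s (g k)) = 1.
  have [uk wk] := gU k; apply: fU; first exact/lift_on_unitary/uk/cuntz_pairC.
  by rewrite /lift_on; repeat constructor.
have [|p [q [wp wq pq hq hp]]] := fixed_split hS lU rU.
  by move=> k l; rewrite -fM -[1]f1 -!fD lift_on_mul.
(* The images of the lifts to the range of s fix q, so f(s)^* kills q; the
   same holds for t and p. *)
have sq : f (star s) * q = 0.
  exact: (star_endo_corner hS (hq true) (hq false)).
have tp : f (star t) * p = 0.
  exact: (star_endo_corner (cuntz_pairC hS) (hp true) (hp false)).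
have [_ _ e] := hS.
have fs : f (s * star s) = p.
  have -> : f (s * star s) = f (s * star s) * p.
    by rewrite -[LHS]mulr1 -pq mulrDr fM -!(mulrA (f s)) sq mulr0 addr0.
  by rewrite -[RHS]mul1r -f1 -e fD mulrDl
      (fM t) -(mulrA (f t)) tp mulr0 addr0.
have ft : f (t * star t) = q.
  by apply: (@addrI _ p); rewrite -[in LHS]fs -fD e rmorph1.
have wg k : word_sum S (f (g k)) by case: (gU k) => uk wk; case: (fU _ uk wk).
have wr : word_sum S (f (star (rot s t))).
  by rewrite hf; apply: ws_star; exact: (wg true).
have ws : word_sum S (f s).
  rewrite -[X in f X](gen1_rot_swap hS) fD.
  rewrite -(mulrA _ s) -(mulrA _ t) !fM -!(fM _ (star _)) fs ft.
  by repeat apply: word_sumM || apply: word_sumD; rewrite // -/(g false).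
case: (letterP i) => -> //.
have -> : t = swap s t * s.
  by rewrite /swap mulrDl -!mulrA !(cuntz_pairE hS) mulr0 mulr1 add0r.
by rewrite fM; apply: word_sumM => //; exact: (wg false).
Qed.

End StarEndomorphism.

Theorem theorem3p21 (R : realType) (A : cstarAlgType R) (S : 'I_2 -> A)
    (hS : is_cuntz2 S) (u : A) (hu : unitary u)
    (lambda_u : {lrmorphism A -> A}) (hstar : star_endomorphism lambda_u)
    (hlambda : forall i, lambda_u (S i) = u * S i) :
  lambda_u @` thompsonV S `<=` thompsonV S <-> thompsonV S u.
Proof.
have pS : cuntz_pair (S ord0) (S ord_max).
  by case: hS => iso e _; split; rewrite ?iso // -e big_ord_recr big_ord1 /=;
    congr (S _ * star (S _) + _); apply: val_inj.
split=> [hV|/(thompsonVE pS)[_ wu] _ [v /(thompsonVE pS)[uv wv] <-]].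
  apply/(thompsonVE pS); split=> //.
  have [_ _ e] := pS; rewrite -[u]mulr1 -e mulrDr !mulrA -!hlambda.
  have fS := word_sum_gens pS hstar
    (fun v hv => hV _ (ex_intro2 _ _ v hv erefl)).
  by apply: word_sumD; apply: word_sumM => //; constructor.
apply/(thompsonVE pS); split; first exact: star_endo_unitary.
apply: star_endo_word_sum => // i; rewrite hlambda.
by apply: word_sumM => //; constructor.
Qed.
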